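(* Let $$A_1 = \begin{pmatrix} 1&1&0&0&1&0\\ 0&1&1&0&1&1\\ 0&0&1&1&0&1\\ 1&1&0&1&0&1\\ 0&0&1&0&1&0\\ 1&0&1&1&1&0\end{pmatrix},\quad A_2 = \begin{pmatrix} 1&1&1&0&0&1\\ 0&1&0&1&0&1\\ 0&0&1&0&0&1\\ 0&0&0&1&1&0\\ 1&0&1&0&1&0\\ 1&1&0&1&1&0\end{pmatrix},$$ $$A_3 = \begin{pmatrix} 1&1&1&0&0&0\\ 0&1&1&1&0&0\\ 0&0&1&1&1&0\\ 0&0&0&1&1&1\\ 1&0&0&0&1&1\\ 0&1&0&1&0&1\end{pmatrix},\quad C_6 = \begin{pmatrix} 1&1&1&0&0&0\\ 0&1&1&1&0&0\\ 0&0&1&1&1&0\\ 0&0&0&1&1&1\\ 1&0&0&0&1&1\\ 1&1&0&0&0&1\end{pmatrix}.$$ Let $M$ be a basic $0,1$ matrix of size $6\times 6$ with $\mathrm{rank}_{\mathbb{R}}(M) = 4$. Then either $M$ has the $2$-sum property, in which case $\mathrm{rank}_{\mathrm{bin}}(M) \leq 5$ and $\mathrm{rank}_{\mathbb{B}}(M) \leq 5$, or $M$ is equivalent to one of $C_6, A_1, A_2, A_3$, and it holds: (1) If $M$ is equivalent to $A_1$ or $A_2$, then $\mathrm{rank}_{\mathrm{bin}}(M) = \mathrm{rank}_{\mathbb{B}}(M) = i(M) = 5$. (2) If $M$ is equivalent to $A_3$, then $\mathrm{rank}_{\mathrm{bin}}(M) = \mathrm{rank}_{\mathbb{B}}(M)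 = 6$ and $i(M) = 5$. (3) If $M$ is equivalent to $C_6$, then $\mathrm{rank}_{\mathrm{bin}}(M) = \mathrm{rank}_{\mathbb{B}}(M) = i(M) = 6$.
   Context: A $0,1$ matrix is basic if it has no all-zero rows or columns, no two identical rows and no two identical columns. A $0,1$ matrix has the $2$-sum property if it has two rows whose sum (over the integers) equals a third row, or two columns whose sum equals a third column. Two matrices are equivalent if one can be obtained from the other by permuting rows, permuting columns, and possibly transposing. $\mathrm{rank}_{\mathbb{R}}(M)$ is the usual rank over $\mathbb{R}$. For a $0,1$ matrix $M$ of size $n\times m$, the binary rank $\mathrm{rank}_{\mathrm{bin}}(M)$ is the minimal $d$ for which there are $0,1$ matrices $A$ ($n\times d$) and $B$ ($d\times m$) with $M = A\cdot B$ over the integers; equivalently, the minimum number of all-one combinatorial rectangles (submatrices all of whose entries are $1$) needed to partition the ones of $M$. The Boolean rank $\mathrm{rank}_{\mathbb{B}}(M)$ is defined in the same way with Boolean arithmetic ($1+1=1$); equivalently, the minimum number of all-one combinatorial rectangles needed to cover the ones of $M$ (overlaps allowed). An isolation set of $M$ is a set of $1$-entries of $M$ such that no two of them are in the same row or column and no two of them belong to an all-one $2\times 2$ submatrix of $M$; $i(M)$ is the maximum size of an isolation set of $M$. *)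

(* Defs.v *)
From mathcomp Require Import all_boot all_order all_fingroup all_algebra.
From mathcomp Require Import reals.

Set Implicit Arguments.
Unset Strict Implicit.
Unset Printing Implicit Defensive.

Import GRing.Theory.

(* A 0,1 matrix of size n x m is represented by M : 'M[bool]_(n, m).  MathComp
   equips bool with the field structure of F_2, so that +, *m and \rank on
   'M[bool] would be computed modulo 2: arithmetic is only ever performed after
   the coercion [mx01 R M] to a ring R, or with explicit Boolean operations. *)
Definition mx01 (R : pzRingType) n m (M : 'M[bool]_(n, m)) : 'M[R]_(n, m) :=
  map_mx (fun b : bool => (b%:R)%R) M.

Definition basic_rows n m (M : 'M[bool]_(n, m)) : bool :=
  [forall i, [exists j, M i j]] &&
  [forall i1, forall i2, (row i1 M == row i2 M) ==> (i1 == i2)].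

Definition basic n m (M : 'M[bool]_(n, m)) : bool :=
  basic_rows M && basic_rows M^T.

Definition two_sum_rows n m (M : 'M[bool]_(n, m)) : bool :=
  [exists i1, exists i2, exists i3,
    [&& i1 != i2, i1 != i3, i2 != i3 &
        (row i1 (mx01 int M) + row i2 (mx01 int M) == row i3 (mx01 int M))%R]].

Definition two_sum_property n m (M : 'M[bool]_(n, m)) : bool :=
  two_sum_rows M || two_sum_rows M^T.

Definition equivalent n (M N : 'M[bool]_n) : bool :=
  [exists s : 'S_n, exists t : 'S_n,
    (M == row_perm s (col_perm t N)) || (M == row_perm s (col_perm t N^T))].

Definition bin_factor n m (M : 'M[bool]_(n, m)) (d : nat) : bool :=
  [exists A : 'M[bool]_(n, d), exists B : 'M[bool]_(d, m),
    mx01 int M == (mx01 int A *m mx01 int B)%R].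

Definition bool_mulmx n d m (A : 'M[bool]_(n, d)) (B : 'M[bool]_(d, m)) :
    'M[bool]_(n, m) :=
  (\matrix_(i, j) \big[orb/false]_(k < d) (A i k && B k j))%R.

Definition bool_factor n m (M : 'M[bool]_(n, m)) (d : nat) : bool :=
  [exists A : 'M[bool]_(n, d), exists B : 'M[bool]_(d, m),
    M == bool_mulmx A B].

Definition id01 n : 'M[bool]_n := (\matrix_(i, j) (i == j))%R.

Lemma bin_factor_ex n m (M : 'M[bool]_(n, m)) : exists d, bin_factor M d.
Proof.
exists n; apply/existsP; exists (id01 n); apply/existsP; exists M.
apply/eqP; rewrite -[LHS]mul1mx; congr (_ *m _)%R.
by apply/matrixP => i j; rewrite !mxE.
Qed.

Lemma bool_factor_ex n m (M : 'M[bool]_(n, m)) : exists d, bool_factor M d.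
Proof.
exists n; apply/existsP; exists (id01 n); apply/existsP; exists M.
apply/eqP/matrixP => i j; rewrite mxE (bigD1 i) //= mxE eqxx /= big1 ?orbF //.
by move=> k kNi; rewrite mxE eq_sym (negbTE kNi).
Qed.

Definition rank_bin n m (M : 'M[bool]_(n, m)) : nat := ex_minn (bin_factor_ex M).

Definition rank_bool n m (M : 'M[bool]_(n, m)) : nat := ex_minn (bool_factor_ex M).

Definition in_ones2x2 n m (M : 'M[bool]_(n, m)) (p q : 'I_n * 'I_m) : bool :=
  [exists I : {set 'I_n}, exists J : {set 'I_m},
    [&& #|I| == 2, #|J| == 2,
        [forall i in I, forall j in J, M i j],
        p \in setX I J & q \in setX I J]].

Definition isolation_set n m (M : 'M[bool]_(n, m)) (S : {set 'I_n * 'I_m}) : bool :=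
  [forall p in S, M p.1 p.2] &&
  [forall p in S, forall q in S, (p != q) ==>
    [&& p.1 != q.1, p.2 != q.2 & ~~ in_ones2x2 M p q]].

Definition isolation_number n m (M : 'M[bool]_(n, m)) : nat :=
  \max_(S : {set 'I_n * 'I_m} | isolation_set M S) #|S|.

Definition mx_of_rows n (s : seq (seq nat)) : 'M[bool]_n :=
  (\matrix_(i, j) (nth 0%N (nth [::] s i) j == 1%N))%R.

Definition A1 : 'M[bool]_6 := mx_of_rows 6
  [:: [:: 1; 1; 0; 0; 1; 0];
      [:: 0; 1; 1; 0; 1; 1];
      [:: 0; 0; 1; 1; 0; 1];
      [:: 1; 1; 0; 1; 0; 1];
      [:: 0; 0; 1; 0; 1; 0];
      [:: 1; 0; 1; 1; 1; 0]].

Definition A2 : 'M[bool]_6 := mx_of_rows 6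
  [:: [:: 1; 1; 1; 0; 0; 1];
      [:: 0; 1; 0; 1; 0; 1];
      [:: 0; 0; 1; 0; 0; 1];
      [:: 0; 0; 0; 1; 1; 0];
      [:: 1; 0; 1; 0; 1; 0];
      [:: 1; 1; 0; 1; 1; 0]].

Definition A3 : 'M[bool]_6 := mx_of_rows 6
  [:: [:: 1; 1; 1; 0; 0; 0];
      [:: 0; 1; 1; 1; 0; 0];
      [:: 0; 0; 1; 1; 1; 0];
      [:: 0; 0; 0; 1; 1; 1];
      [:: 1; 0; 0; 0; 1; 1];
      [:: 0; 1; 0; 1; 0; 1]].

Definition C6 : 'M[bool]_6 := mx_of_rows 6
  [:: [:: 1; 1; 1; 0; 0; 0];
      [:: 0; 1; 1; 1; 0; 0];
      [:: 0; 0; 1; 1; 1; 0];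
      [:: 0; 0; 0; 1; 1; 1];
      [:: 1; 0; 0; 0; 1; 1];
      [:: 1; 1; 0; 0; 0; 1]].

(* Main.v *)
Require Import Defs.
From mathcomp Require Import all_boot all_order all_fingroup all_algebra.
From mathcomp Require Import reals.
From mathcomp Require Import zify.

(** The statement has two independent halves.

    The ranks.  The chain [isolation_number <= rank_bool <= rank_bin] holds for
    every matrix, and its three terms are invariant under equivalence, so only a
    2-sum and the four matrices themselves have to be treated.  If one row is
    the sum of two others, the remaining rows, each taken as a rectangle of its
    own, partition the ones once the two summands are extended to the third row
    ([two_sum_rank_bin]).  In the four matrices the isolated entries can be taken
    on the diagonal; for [A1] and [A2] they meet a partition into five
    rectangles, and for [C6] they are six.  For [A3] isolation is not enough, but
    a weighted version of it is: counting lines from 0, give weight 2 to the one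
    in row 4 and column 0, and weight 1 to nine others; then no rectangle of ones
    has weight more than 2, whereas the total weight is 11, so five rectangles
    cannot cover ([rank_bool_fooling], [A3_ranks]).

    The classification.  A matrix of rank 4 has a nonsingular 4 x 4 submatrix,
    which permutations bring to the upper left corner.  In the resulting blocks
    B, C (right), R (below), D, the block D is forced by
    [det B * D = R * adj B * C] ([schur_adj]), and linear relations between rows
    can be read off the first four columns ([lsubmx_relation]); so the hypotheses
    on M become conditions on B and R (rows) and on B and C (columns).  To
    remove most of the symmetry, the permutations are chosen so that B stays
    nonsingular and the sum of 2^(5-i) * 2^(5-j) over the ones (i, j) of the
    matrix is least.  Exchanging two rows then cannot decrease this sum, which
    says that the two rows are in lexicographic order, except when the exchange
    makes B singular.  Hence the rows of B are increasing, the two rows of R are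
    increasing, and a row r of R comes after each row of B that has a nonzero
    coefficient when r is written in terms of the rows of B; by Cramer's rule
    these coefficients are the entries of [r * adj B] up to the factor det B
    ([pivot_exchange]).  The same holds for columns.  An enumeration under these
    constraints leaves 171 blocks B and 38 matrices, each of which is recognized
    as one of the four by a search for the permutations ([pivots_checked]). *)

Set Implicit Arguments.
Unset Strict Implicit.
Unset Printing Implicit Defensive.

Import GRing.Theory Num.Theory.
Local Open Scope ring_scope.

(** * Equivalence of matrices *)

Lemma equivalentP n (M N : 'M[bool]_n) :
  reflect (exists s t : 'S_n, (forall i j, M i j = N (s i) (t j)) \/
                              (forall i j, M i j = N (t j) (s i)))
          (equivalent M N).
Proof.
apply: (iffP existsP) => [[s /existsP[t /orP[]/eqP->]]|[s [t]] MN].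
- by exists s, t; left=> i j; rewrite !mxE.
- by exists s, t; right=> i j; rewrite !mxE.
exists s; apply/existsP; exists t; apply/orP; case: MN => MN; [left|right].
  by apply/eqP/matrixP=> i j; rewrite !mxE.
by apply/eqP/matrixP=> i j; rewrite !mxE.
Qed.

Lemma equivalent_sym n (M N : 'M[bool]_n) : equivalent M N -> equivalent N M.
Proof.
case/equivalentP=> s [t [] MN]; apply/equivalentP.
  by exists s^-1%g, t^-1%g; left=> i j; rewrite MN !permKV.
by exists t^-1%g, s^-1%g; right=> i j; rewrite MN !permKV.
Qed.

Lemma equivalent_trans n (M N P : 'M[bool]_n) :
  equivalent M N -> equivalent N P -> equivalent M P.
Proof.
case/equivalentP=> s [t MN] /equivalentP[s' [t' NP]]; apply/equivalentP.
case: MN NP => MN [] NP.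
- by exists (s * s')%g, (t * t')%g; left=> i j; rewrite MN NP !permM.
- by exists (s * s')%g, (t * t')%g; right=> i j; rewrite MN NP !permM.
- by exists (s * t')%g, (t * s')%g; right=> i j; rewrite MN NP !permM.
by exists (s * t')%g, (t * s')%g; left=> i j; rewrite MN NP !permM.
Qed.

Lemma equivalent_invariant n (rk : 'M[bool]_n -> nat) :
    (forall (M N : 'M_n) (s t : 'S_n),
       (forall i j, M i j = N (s i) (t j)) -> (rk M <= rk N)%N) ->
    (forall M, rk M^T <= rk M)%N ->
  forall M N, equivalent M N -> rk M = rk N.
Proof.
move=> rk_perm rk_tr M N eqMN; apply/eqP; rewrite eqn_leq.
have le_rk P Q : equivalent P Q -> (rk P <= rk Q)%N.
  case/equivalentP=> s [t [] PQ]; first exact: rk_perm PQ.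
  by apply: leq_trans (rk_tr Q); apply: (rk_perm _ _ s t) => i j; rewrite PQ mxE.
by rewrite !le_rk // equivalent_sym.
Qed.

(** * Binary and Boolean rank *)

Lemma rank_bin_le n m (M : 'M[bool]_(n, m)) d :
  bin_factor M d -> (rank_bin M <= d)%N.
Proof. by rewrite /rank_bin; case: ex_minnP => r _; apply. Qed.

Lemma rank_bool_le n m (M : 'M[bool]_(n, m)) d :
  bool_factor M d -> (rank_bool M <= d)%N.
Proof. by rewrite /rank_bool; case: ex_minnP => r _; apply. Qed.

Lemma bool_factorP n m (M : 'M[bool]_(n, m)) d :
  reflect (exists (A : 'I_n -> 'I_d -> bool) (B : 'I_d -> 'I_m -> bool),
             forall i j, M i j = [exists k, A i k && B k j])
          (bool_factor M d).
Proof.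
apply: (iffP existsP) => [[A /existsP[B /eqP MAB]]|[A [B MAB]]].
  by exists A, B => i j; rewrite MAB mxE big_orE.
exists (\matrix_(i, k) A i k); apply/existsP; exists (\matrix_(k, j) B k j).
apply/eqP/matrixP=> i j; rewrite MAB mxE big_orE.
by apply: eq_existsb => k; rewrite !mxE.
Qed.

Lemma bin_factorP n m (M : 'M[bool]_(n, m)) d :
  reflect (exists (A : 'I_n -> 'I_d -> bool) (B : 'I_d -> 'I_m -> bool),
             forall i j, M i j = \sum_k (A i k && B k j) :> nat)%N
          (bin_factor M d).
Proof.
have prodE (A : 'M[bool]_(n, d)) (B : 'M[bool]_(d, m)) i j :
    (mx01 int A *m mx01 int B) i j = (\sum_k (A i k && B k j))%N%:R.
  rewrite mxE natr_sum; apply: eq_bigr => k _; rewrite !mxE.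
  by rewrite -natrM mulnb.
apply: (iffP existsP) => [[A /existsP[B /eqP/matrixP MAB]]|[A [B MAB]]].
  exists A, B => i j; have := MAB i j; rewrite prodE !mxE => /eqP.
  by rewrite eqr_nat => /eqP.
exists (\matrix_(i, k) A i k); apply/existsP; exists (\matrix_(k, j) B k j).
apply/eqP/matrixP=> i j; rewrite prodE !mxE MAB; congr (_%:R).
by apply: eq_bigr => k _; rewrite !mxE.
Qed.

Lemma rank_bool_le_bin n m (M : 'M[bool]_(n, m)) : (rank_bool M <= rank_bin M)%N.
Proof.
apply: rank_bool_le; rewrite /rank_bin.
case: ex_minnP => d /bin_factorP[A [B MAB]] _.
apply/bool_factorP; exists A, B => i j; have := MAB i j.
case: existsP => [[k ABk]|noAB].
  by rewrite (bigD1 k) //= ABk; case: (M i j).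
rewrite big1 => [|k _]; first by case: (M i j).
by apply/eqP; rewrite eqb0; apply/negP=> ABk; case: noAB; exists k.
Qed.

(** Arbitrary maps of the indices are allowed: taking a submatrix and repeating
    lines both keep a factorization. *)
Lemma rank_bin_reindex n m n' m'
    (M : 'M[bool]_(n, m)) (N : 'M[bool]_(n', m')) f g :
  (forall i j, M i j = N (f i) (g j)) -> (rank_bin M <= rank_bin N)%N.
Proof.
move=> MN; apply: rank_bin_le; rewrite /rank_bin.
case: ex_minnP => d /bin_factorP[A [B NAB]] _.
by apply/bin_factorP; exists (A \o f), (fun k => B k \o g) => i j; rewrite MN NAB.
Qed.

Lemma rank_bool_reindex n m n' m'
    (M : 'M[bool]_(n, m)) (N : 'M[bool]_(n', m')) f g :
  (forall i j, M i j = N (f i) (g j)) -> (rank_bool M <= rank_bool N)%N.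
Proof.
move=> MN; apply: rank_bool_le; rewrite /rank_bool.
case: ex_minnP => d /bool_factorP[A [B NAB]] _.
by apply/bool_factorP; exists (A \o f), (fun k => B k \o g) => i j; rewrite MN NAB.
Qed.

Lemma rank_bin_tr n m (M : 'M[bool]_(n, m)) : (rank_bin M^T <= rank_bin M)%N.
Proof.
apply: rank_bin_le; rewrite /rank_bin.
case: ex_minnP => d /bin_factorP[A [B MAB]] _.
apply/bin_factorP; exists (fun j k => B k j), (fun k i => A i k) => j i.
by rewrite mxE MAB; apply: eq_bigr => k _; rewrite andbC.
Qed.

Lemma rank_bool_tr n m (M : 'M[bool]_(n, m)) : (rank_bool M^T <= rank_bool M)%N.
Proof.
apply: rank_bool_le; rewrite /rank_bool.
case: ex_minnP => d /bool_factorP[A [B MAB]] _.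
apply/bool_factorP; exists (fun j k => B k j), (fun k i => A i k) => j i.
by rewrite mxE MAB; apply: eq_existsb => k; rewrite andbC.
Qed.

Lemma rank_bin_equivalent n (M N : 'M[bool]_n) :
  equivalent M N -> rank_bin M = rank_bin N.
Proof.
by move: M N; apply: equivalent_invariant => [M N s t|M];
  [apply: rank_bin_reindex | apply: rank_bin_tr].
Qed.

Lemma rank_bool_equivalent n (M N : 'M[bool]_n) :
  equivalent M N -> rank_bool M = rank_bool N.
Proof.
by move: M N; apply: equivalent_invariant => [M N s t|M];
  [apply: rank_bool_reindex | apply: rank_bool_tr].
Qed.

Lemma rank_bin_max n m (M : 'M[bool]_(n, m)) : (rank_bin M <= n)%N.
Proof.
apply/rank_bin_le/bin_factorP; exists (fun i k => i == k), M => i j.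
by rewrite (bigD1 i) //= eqxx big1 ?addn0 // => k; rewrite eq_sym => /negbTE->.
Qed.

Lemma two_sum_rowsP n m (M : 'M[bool]_(n, m)) :
  reflect (exists i1 i2 i3, [/\ i1 != i2, i1 != i3, i2 != i3 &
             forall j, M i1 j + M i2 j = M i3 j :> nat]%N)
          (two_sum_rows M).
Proof.
have sumE i1 i2 i3 : reflect (forall j, M i1 j + M i2 j = M i3 j :> nat)%N
    (row i1 (mx01 int M) + row i2 (mx01 int M) == row i3 (mx01 int M)).
  apply: (iffP eqP) => [/rowP eqM j | eqM]; last apply/rowP=> j.
    by have := eqM j; rewrite !mxE -natrD => /eqP; rewrite eqr_nat => /eqP.
  by rewrite !mxE -natrD eqM.
apply: (iffP existsP) => [[i1 /existsP[i2 /existsP[i3]]]|].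
  by move=> /and4P[n12 n13 n23 /sumE eqM]; exists i1, i2, i3.
case=> i1 [i2 [i3 [n12 n13 n23 eqM]]]; exists i1; apply/existsP; exists i2.
by apply/existsP; exists i3; rewrite n12 n13 n23; apply/sumE.
Qed.

(** Each row other than the sum is a rectangle of its own; the rectangles of the
    two summands are extended to the row [i3], where they are disjoint because
    their integer sum is a 0,1 vector. *)
Lemma two_sum_rank_bin n m (M : 'M[bool]_(n.+1, m)) :
  two_sum_rows M -> (rank_bin M <= n)%N.
Proof.
case/two_sum_rowsP=> i1 [i2 [i3 [n12 n13 n23 M123]]].
apply/rank_bin_le/bin_factorP.
pose A i k :=
  if i == i3 then (lift i3 k == i1) || (lift i3 k == i2) else lift i3 k == i.
exists A, (fun k j => M (lift i3 k) j) => i j; rewrite /A.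
have [->|ni3] := eqVneq i i3.
  transitivity (\sum_(k | k != i3) (((k == i1) || (k == i2)) && M k j))%N.
    rewrite (bigD1 i1) //= eqxx (bigD1 i2) //=; last by rewrite n23 eq_sym.
    rewrite eqxx orbT big1 ?addn0 ?M123 // => k /andP[/andP[_ /negbTE->] /negbTE->].
    by [].
  rewrite (reindex_omap (lift i3) (unlift i3)) /= => [|k nk].
    by apply: eq_bigl => k; rewrite liftK eqxx andbT eq_sym neq_lift.
  by case: unliftP nk => [l ->|->] //; rewrite eqxx.
have [k ->] : exists k, i = lift i3 k.
  by rewrite eq_sym in ni3; case: (unlift_some ni3) => k; exists k.
rewrite (bigD1 k) //= eqxx big1 ?addn0 // => l nlk.
by rewrite (inj_eq lift_inj) (negbTE nlk).
Qed.

(** * Isolation sets *)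

Definition compatible n m (M : 'M[bool]_(n, m)) (p q : 'I_n * 'I_m) : bool :=
  M p.1 q.2 && M q.1 p.2.

(** Incompatibility alone characterizes isolation: two ones in a common row or
    column are always compatible. *)
Lemma isolation_setP n m (M : 'M[bool]_(n, m)) (S : {set 'I_n * 'I_m}) :
  reflect ({in S, forall p, M p.1 p.2} /\
           {in S &, forall p q, compatible M p q -> p = q})
          (isolation_set M S).
Proof.
apply: (iffP andP) => [[/forall_inP S1 /forall_inP iS]|[S1 iS]]; split=> //.
- move=> p q Sp Sq /andP[Mpq Mqp]; apply/eqP; apply: contraT => npq.
  have /forall_inP/(_ q Sq) := iS p Sp; rewrite npq /= => /and3P[n1 n2] /negP[].
  apply/existsP; exists [set p.1; q.1].
  apply/existsP; exists [set p.2; q.2].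
  rewrite !cards2 n1 n2 !inE !eqxx !orbT !andbT /=.
  apply/forall_inP=> i Ii; apply/forall_inP=> j; move: Ii; rewrite !inE.
  by do 2!case/pred2P=> ->; rewrite ?Mpq ?Mqp ?S1.
- exact/forall_inP.
apply/forall_inP=> p Sp; apply/forall_inP=> q Sq; apply/implyP=> npq.
have ncomp : ~~ compatible M p q by apply: contra_neqN npq => /(iS p q Sp Sq).
apply/and3P; split.
- by apply: contraNneq ncomp => eq1; rewrite /compatible eq1 S1 // -eq1 S1.
- by apply: contraNneq ncomp => eq2; rewrite /compatible -eq2 S1 // eq2 S1.
apply: contra ncomp => /existsP[I /existsP[J /and5P[_ _ /forall_inP MIJ]]].
rewrite !inE => /andP[pI pJ] /andP[qI qJ].
by rewrite /compatible (forall_inP (MIJ _ pI)) // (forall_inP (MIJ _ qI)).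
Qed.

(** The ones that fall into a common rectangle of a cover are pairwise
    compatible, so a bound [c] on the size of the compatible subfamilies bounds
    the number of ones that each rectangle covers.  The family [p] may repeat
    entries, which amounts to integer weights; [c = 1] is the bound by isolation
    sets. *)
Lemma rank_bool_fooling n m (M : 'M[bool]_(n, m)) (I : finType)
    (p : I -> 'I_n * 'I_m) c :
    (forall a, M (p a).1 (p a).2) ->
    (forall K : {set I},
       {in K &, forall a b, compatible M (p a) (p b)} -> (#|K| <= c)%N) ->
  (#|I| <= c * rank_bool M)%N.
Proof.
move=> M1 cliques; rewrite /rank_bool.
case: ex_minnP => d /bool_factorP[A [B MAB]] _.
have cover a : exists k, A (p a).1 k && B k (p a).2 by apply/existsP; rewrite -MAB.
pose rect a := xchoose (cover a).
have rectP a : A (p a).1 (rect a) && B (rect a) (p a).2 := xchooseP (cover a).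
rewrite -sum1_card (partition_big rect xpredT) //=.
have -> : (c * d = \sum_(k < d) c)%N by rewrite sum_nat_const card_ord mulnC.
apply: leq_sum => k _; rewrite sum1_card -(cardsE (fun a => rect a == k)).
apply: cliques => a b; rewrite !inE => /eqP ak /eqP bk.
have := rectP a; have := rectP b; rewrite ak bk => /andP[Ab Bb] /andP[Aa Ba].
by apply/andP; split; rewrite MAB; apply/existsP; exists k; rewrite ?Aa ?Bb ?Ab ?Ba.
Qed.

Lemma isolation_le_rank_bool n m (M : 'M[bool]_(n, m)) :
  (isolation_number M <= rank_bool M)%N.
Proof.
apply/bigmax_leqP=> S /isolation_setP[S1 iS].
rewrite -[leqRHS]mul1n -[#|S|](card_sig (mem S)).
apply: (rank_bool_fooling (p := val)) => [[p Sp] | K compK]; first exact: S1.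
apply/card_le1_eqP => a b Ka Kb; apply/esym/val_inj.
by apply: iS (valP a) (valP b) (compK a b Ka Kb).
Qed.

Lemma isolation_number_ge n m (M : 'M[bool]_(n, m)) (S : {set 'I_n * 'I_m}) :
  isolation_set M S -> (#|S| <= isolation_number M)%N.
Proof. exact: leq_bigmax_cond. Qed.

Lemma isolation_reindex n m n' m'
    (M : 'M[bool]_(n, m)) (N : 'M[bool]_(n', m')) f g :
    injective f -> injective g -> (forall i j, M i j = N (f i) (g j)) ->
  (isolation_number M <= isolation_number N)%N.
Proof.
move=> f_inj g_inj MN; apply/bigmax_leqP=> S /isolation_setP[S1 iS].
pose h (p : 'I_n * 'I_m) := (f p.1, g p.2).
have h_inj : injective h by move=> [i j] [i' j'] [/f_inj-> /g_inj->].
rewrite -(card_imset _ h_inj); apply/isolation_number_ge/isolation_setP; split.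
  by move=> _ /imsetP[p Sp ->]; rewrite -MN S1.
move=> _ _ /imsetP[p Sp ->] /imsetP[q Sq ->]; rewrite /compatible /= -!MN.
by move/(iS p q Sp Sq)->.
Qed.

Lemma isolation_tr n m (M : 'M[bool]_(n, m)) :
  (isolation_number M^T <= isolation_number M)%N.
Proof.
apply/bigmax_leqP=> S /isolation_setP[S1 iS].
pose h (p : 'I_m * 'I_n) := (p.2, p.1).
have h_inj : injective h by move=> [i j] [i' j'] [-> ->].
rewrite -(card_imset _ h_inj); apply/isolation_number_ge/isolation_setP; split.
  by move=> _ /imsetP[p Sp ->]; have := S1 p Sp; rewrite mxE.
move=> _ _ /imsetP[p Sp ->] /imsetP[q Sq ->]; rewrite /compatible /= => Mpq.
by rewrite (iS p q) // /compatible !mxE andbC.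
Qed.

Lemma isolation_equivalent n (M N : 'M[bool]_n) :
  equivalent M N -> isolation_number M = isolation_number N.
Proof.
move: M N; apply: equivalent_invariant => [M N s t|M]; last exact: isolation_tr.
by apply: isolation_reindex; apply: perm_inj.
Qed.

(** * Matrices as tables, and backtracking *)

Local Notation table := (seq (seq bool)).

Definition cell (L : table) i j : bool := nth false (nth [::] L i) j.

Definition transpose_table n (L : table) : table :=
  [seq [seq nth false r j | r <- L] | j <- iota 0 n].

Definition bits (s : seq (seq nat)) : table :=
  [seq [seq x == 1%N | x <- r] | r <- s].

Definition tabulates (L : table) (M : 'M[bool]_6) : Prop :=
  size L = 6 /\ forall i j : 'I_6, M i j = cell L i j.

Lemma tabulates_tr L M : tabulates L M -> tabulates (transpose_table 6 L) M^T.
Proof.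
case=> sL ML; split=> // i j; rewrite mxE ML /cell (nth_map 0%N) ?size_iota //.
by rewrite (nth_map [::]) ?sL // nth_iota.
Qed.

Lemma tabulates_rows r : size r = 6 -> tabulates (bits r) (mx_of_rows 6 r).
Proof.
move=> sr; split=> [|i j]; first by rewrite size_map.
rewrite mxE /cell (nth_map [::]) ?sr //.
case: (ltnP j (size (nth [::] r i))) => [lt|ge]; first by rewrite (nth_map 0%N).
by rewrite (nth_default 0%N ge) nth_default ?size_map.
Qed.

(** The sequences with one term from each member of [Cs] all of whose nonempty
    suffixes satisfy [ok]; pruning on suffixes makes this a backtracking search. *)
Fixpoint choices T (ok : pred (seq T)) (Cs : seq (seq T)) : seq (seq T) :=
  if Cs is C :: Cs' then
    flatten [seq [seq x :: s | x <- C & ok (x :: s)] | s <- choices ok Cs']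
  else [:: [::]].

Lemma choices_complete (T : eqType) (ok : pred (seq T)) (Cs : seq (seq T)) s :
    (forall x u, ok (x :: u) -> ok u) ->
  ok s -> all2 (fun x C => x \in C) s Cs -> s \in choices ok Cs.
Proof.
move=> okW; elim: Cs s => [|C Cs IHCs] [|x s] //= ok_xs /andP[Cx sCs].
apply/flatten_mapP; exists s; first exact: IHCs (okW _ _ ok_xs) sCs.
by apply/mapP; exists x; rewrite // mem_filter ok_xs.
Qed.

Lemma choices_nseq (T : eqType) (ok : pred (seq T)) C n s :
  s \in choices ok (nseq n.+1 C) -> [/\ size s = n.+1, {subset s <= C} & ok s].
Proof.
elim: n s => [|n IHn] s /flatten_mapP[u].
  rewrite inE => /eqP-> /mapP[x]; rewrite mem_filter => /andP[ok_x Cx] ->.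
  by split=> // y; rewrite inE => /eqP->.
move=> /IHn[su uC _] /mapP[x]; rewrite mem_filter => /andP[ok_xu Cx] ->.
by split=> //=; [rewrite su | move=> y; rewrite inE => /predU1P[->|/uC]].
Qed.

Fixpoint words n : seq (seq bool) :=
  if n is m.+1 then [seq b :: w | b <- [:: false; true], w <- words m]
  else [:: [::]].

Lemma mem_words w : w \in words (size w).
Proof.
elim: w => [|b w IHw] //=; rewrite cats0 mem_cat.
by case: b; rewrite (map_f (cons _) IHw) ?orbT.
Qed.

Lemma perm_of_iota n (Is : seq nat) : perm_eq Is (iota 0 n.+1) ->
  exists s : 'S_n.+1, forall i : 'I_n.+1, nth 0%N Is i = s i.
Proof.
move=> pI; have sI : size Is = n.+1 by rewrite (perm_size pI) size_iota.
have ltI (i : 'I_n.+1) : (nth 0%N Is i < n.+1)%N.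
  have: nth 0%N Is i \in iota 0 n.+1 by rewrite -(perm_mem pI) mem_nth ?sI.
  by rewrite mem_iota.
have injI : injective (fun i => Ordinal (ltI i)).
  move=> i j [/eqP]; rewrite nth_uniq ?sI // => [/eqP/val_inj //|].
  by rewrite (perm_uniq pI) iota_uniq.
by exists (perm injI) => i; rewrite permE.
Qed.

(** A search for rows [Is] of [L], to be matched in order with the rows of [N].
    It suffices to choose the rows: the columns can be matched exactly when they
    agree as multisets, and a partial choice is pruned by the same test on the
    last rows of [N]. *)
Definition permutable (L N : table) : bool :=
  choices (fun Is => if uniq Is then
     perm_eq (transpose_table 6 [seq nth [::] L i | i <- Is])
             (transpose_table 6 (drop (6 - size Is) N))
     else false) (nseq 6 (iota 0 6)) != [::].

Lemma permutable_equivalent L T M N :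
  tabulates L M -> tabulates T N -> permutable L T -> equivalent M N.
Proof.
move=> [_ ML] [sT NT]; rewrite /permutable; case isos: (choices _ _) => [//|Is s] _.
have := mem_head Is s; rewrite -isos => /choices_nseq[sI mI].
case: ifP => // uI; rewrite sI subnn drop0 => /(perm_iotaP [::])[Js pJ trL].
rewrite size_map size_iota in pJ.
have pI : perm_eq Is (iota 0 6).
  have [_ eqI] := uniq_min_size uI mI (eq_leq (esym sI)).
  by apply: uniq_perm eqI; rewrite ?iota_uniq.
have [s' sE] := perm_of_iota pI; have [t tE] := perm_of_iota pJ.
apply: equivalent_sym; apply/equivalentP; exists s', t^-1%g; left=> i j.
rewrite -{1}[j](permKV t) NT ML -sE; set j' := _ j.
have /(congr1 (fun u => nth false (nth [::] u j') i)) := trL.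
have sJ : size Js = 6 by rewrite (perm_size pJ) size_iota.
rewrite (nth_map 0%N) ?size_iota // nth_iota // (nth_map [::]) ?size_map ?sI //.
rewrite (nth_map 0%N) ?sI // add0n /cell => ->; rewrite (nth_map 0%N) ?sJ // tE.
by rewrite (nth_map 0%N) ?size_iota // nth_iota // (nth_map [::]) ?sT // add0n.
Qed.

(** * Determinants of 0,1 tables *)

(* Sums over an explicit list, because a sealed big operator does not
   evaluate. *)
Definition sumz n (f : nat -> int) : int :=
  foldr (fun k acc => f k + acc) 0 (iota 0 n).

Lemma sumzE n f : sumz n f = \sum_(k < n) f k.
Proof.
rewrite -(big_mkord xpredT) /index_iota subn0 /sumz.
by elim: (iota 0 n) => [|k s IHs]; rewrite ?big_nil // big_cons /= IHs.
Qed.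

(** Expansion along the first row. *)
Fixpoint det01 n (A : nat -> nat -> bool) : int :=
  if n is m.+1 then
    sumz n (fun j => if A 0%N j then
      (-1) ^+ j * det01 m (fun k l => A k.+1 (bump j l)) else 0)
  else 1.

Lemma det01E n A : det01 n A = \det (mx01 int (\matrix_(i < n, j < n) A i j)).
Proof.
elim: n A => [|n IHn] A; first by rewrite det_mx00.
rewrite (expand_det_row _ ord0) /= sumzE; apply: eq_bigr => j _.
rewrite !mxE; case: (A _ _); rewrite ?mul0r // mul1r /cofactor add0n IHn.
congr (_ * \det _); apply/matrixP => k l.
by rewrite !mxE.
Qed.

Definition cof01 n (A : nat -> nat -> bool) i j : int :=
  (-1) ^+ (i + j) * det01 n.-1 (fun k l => A (bump i k) (bump j l)).

Lemma cof01E n A (i j : 'I_n.+1) :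
  cof01 n.+1 A i j = cofactor (mx01 int (\matrix_(k < n.+1, l < n.+1) A k l)) i j.
Proof.
rewrite /cof01 det01E /cofactor; congr (_ * \det _).
by apply/matrixP => k l; rewrite !mxE.
Qed.

(** * Matrices whose rank is the size of a nonsingular corner *)

Lemma dsubmx_factor (F : fieldType) m p n (M : 'M[F]_(m + p, n)) :
  row_free (usubmx M) -> \rank M = m -> exists X, dsubmx M = X *m usubmx M.
Proof.
move=> /eqP rU rM; have sUM : (usubmx M <= M)%MS.
  by rewrite -{2}[M]vsubmxK -addsmxE addsmxSl.
have := mxrank_leqif_sup sUM; rewrite rU rM => /leqif_refl sMU.
have: (dsubmx M <= usubmx M)%MS.
  by apply: submx_trans sMU; rewrite -{2}[M]vsubmxK -addsmxE addsmxSr.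
by case/submxP=> X ->; exists X.
Qed.

Lemma usubmx_free (F : fieldType) m p q (M : 'M[F]_(m + p, m + q)) :
  ulsubmx M \in unitmx -> row_free (usubmx M).
Proof.
rewrite -row_free_unit /row_free => /eqP rB; rewrite eqn_leq rank_leq_row /=.
apply: (@leq_trans (\rank (ulsubmx M))); first by rewrite rB.
by rewrite /ulsubmx -[usubmx M]mulmx1 -mulmx_lsub mulmx1 mxrankM_maxl.
Qed.

Section BlockRank.
Variables (F : fieldType) (m p q : nat) (M : 'M[F]_(m + p, m + q)).
Hypotheses (rM : \rank M = m) (uM : ulsubmx M \in unitmx).

(** The lower rows are [X] times the upper ones, so that with blocks B, C, R, D
    one has R = X B and D = X C; multiplying by the adjugate avoids the inverse
    of B and gives an identity between integers when M is integral. *)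
Lemma schur_adj :
  \det (ulsubmx M) *: drsubmx M = dlsubmx M *m \adj (ulsubmx M) *m ursubmx M.
Proof.
have [X dM] := dsubmx_factor (usubmx_free uM) rM.
rewrite /dlsubmx /drsubmx dM -mulmx_lsub -mulmx_rsub -/(ulsubmx M) -/(ursubmx M).
by rewrite -(mulmxA X) mul_mx_adj mul_mx_scalar -scalemxAl.
Qed.

(** The remaining columns are combinations of the first [m]. *)
Lemma lsubmx_relation (a : 'rV[F]_(m + p)) : a *m lsubmx M = 0 -> a *m M = 0.
Proof.
(* Transposition turns the factorization of the lower rows into one of the
   right columns. *)
have rMt : \rank M^T = m by rewrite mxrank_tr.
have uMt : ulsubmx M^T \in unitmx by rewrite -trmx_ulsub unitmx_tr.
have [Y] := dsubmx_factor (usubmx_free uMt) rMt.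
rewrite -trmx_rsub -trmx_lsub => /(congr1 trmx); rewrite trmx_mul !trmxK => rMY a0.
by rewrite -[M]hsubmxK rMY mul_mx_row mulmxA a0 mul0mx row_mx0.
Qed.
End BlockRank.

Lemma det_replace_row (R : comPzRingType) n (B : 'M[R]_n) i (r : 'rV_n) :
  \det (\matrix_(k, j) if k == i then r 0 j else B k j) =
    \sum_j r 0 j * cofactor B i j.
Proof.
rewrite (expand_det_row _ i); apply: eq_bigr => j _; rewrite !mxE eqxx.
congr (_ * (_ * \det _)); apply/matrixP => k l; rewrite !mxE.
by rewrite eq_sym (negbTE (neq_lift _ _)).
Qed.

Lemma mxrank_perm (F : fieldType) m n (A : 'M[F]_(m, n)) (s : 'S_m) (t : 'S_n) :
  \rank (row_perm s (col_perm t A)) = \rank A.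
Proof.
rewrite row_permE col_permE (eqmxMfull _ _) ?row_full_unit ?unitmx_perm //.
by rewrite mxrankMfree // row_free_unit unitmx_perm.
Qed.

Lemma exists_free_rows (F : fieldType) m n r (A : 'M[F]_(m, n)) :
  \rank A = r -> exists2 f : 'I_r -> 'I_m, injective f & row_free (rowsub f A).
Proof.
move=> <-; exists (maxrankfun A); first exact: maxrankfun_inj.
exact: maxrowsub_free.
Qed.

(** * Pivots: nonsingular leading blocks *)

(** Indices are natural numbers so that entries can be listed by evaluation. *)
Definition entry (M : 'M[bool]_6) (i j : nat) : bool := M (inord i) (inord j).

Definition lead_row M i : seq bool := [seq entry M i j | j <- iota 0 4].

Definition lead_block M : table := [seq lead_row M i | i <- iota 0 4].

Definition pivot M : bool := det01 4 (entry M) != 0.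

Lemma entry_tr M i j : entry M^T i j = entry M j i.
Proof. by rewrite /entry mxE. Qed.

Lemma entry_val M (i j : 'I_6) : entry M i j = M i j.
Proof. by rewrite /entry !inord_val. Qed.

Lemma transpose_lead_block M : transpose_table 4 (lead_block M) = lead_block M^T.
Proof. by rewrite /lead_block /lead_row /transpose_table /= !entry_tr. Qed.

Lemma cell_lead_block M i j :
  (i < 4)%N -> (j < 4)%N -> cell (lead_block M) i j = entry M i j.
Proof.
by move=> i4 j4; rewrite /cell /lead_block (nth_map 0%N) ?size_iota // (nth_map 0%N)
  ?size_iota // !nth_iota.
Qed.

Lemma mx_lead_block M :
  \matrix_(i < 4, j < 4) cell (lead_block M) i j =
    \matrix_(i < 4, j < 4) entry M i j.
Proof. by apply/matrixP=> i j; rewrite !mxE cell_lead_block. Qed.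

Lemma pivot_tr M : pivot M^T = pivot M.
Proof.
rewrite /pivot !det01E -[in RHS]det_tr; congr (\det _ != 0).
by apply/matrixP => i j; rewrite !mxE entry_tr.
Qed.

Lemma ulsub_mx01 (R : pzRingType) M :
  @ulsubmx _ 4 2 4 2 (mx01 R M) = mx01 R (\matrix_(i < 4, j < 4) entry M i j).
Proof.
apply/matrixP=> i j; rewrite !mxE -entry_val.
by [].
Qed.

Lemma mx01_int (R : pzRingType) m n (M : 'M[bool]_(m, n)) :
  mx01 R M = map_mx intr (mx01 int M).
Proof. by apply/matrixP => i j; rewrite !mxE; case: (M i j). Qed.

Lemma pivotE (F : numFieldType) M :
  pivot M = (@ulsubmx _ 4 2 4 2 (mx01 F M) \in unitmx).
Proof.
rewrite ulsub_mx01 mx01_int unitmxE det_map_mx -det01E unitfE.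
by rewrite intr_eq0.
Qed.

(** Cramer's rule: up to the factor [det B], the coefficient of row [i] of the
    block B in the expression of row [p] is the determinant obtained by putting
    row [p] in place of row [i]. *)
Lemma pivot_exchange M (i p : 'I_6) : (i < 4)%N -> (4 <= p)%N ->
  pivot (xrow i p M) =
    (\sum_(k < 4) (if entry M p k then cof01 4 (entry M) i k else 0) != 0).
Proof.
move=> i4 p4; rewrite /pivot det01E.
pose i' := Ordinal i4; congr (_ != 0).
pose B := mx01 int (\matrix_(k < 4, l < 4) entry M k l).
transitivity (\det (\matrix_(k, j)
    if k == i' then (\row_j (entry M p j)%:R) 0 j else B k j)).
  congr (\det _); apply/matrixP=> k j; rewrite !mxE /entry mxE -val_eqE /=.
  have k6 : (k < 6)%N by apply: leq_trans (ltn_ord k) _.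
  case: eqP => [ki|/eqP ki].
    by rewrite ki inord_val tpermL inord_val.
  rewrite tpermD //; rewrite -val_eqE /= inordK //; first by rewrite eq_sym.
  by have := ltn_ord k; lia.
rewrite det_replace_row; apply: eq_bigr => k _.
by rewrite mxE (cof01E _ i'); case: (entry _ _ _); rewrite ?mul1r ?mul0r.
Qed.

Lemma pivot_xrow_lead M (i i' : 'I_6) :
  (i < 4)%N -> (i' < 4)%N -> pivot (xrow i i' M) = pivot M.
Proof.
move=> i4 i4'; have -> : pivot (xrow i i' M) =
    (\det (xrow (Ordinal i4) (Ordinal i4')
       (mx01 int (\matrix_(k < 4, l < 4) entry M k l))) != 0).
  rewrite /pivot det01E; congr (\det _ != 0); apply/matrixP=> k l.
  rewrite !mxE /entry mxE.
  have k6 : (k < 6)%N by apply: leq_trans (ltn_ord k) _.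
  have eq_k (j : 'I_6) (j4 : (j < 4)%N) : (inord k == j) = (k == Ordinal j4).
    by rewrite -!val_eqE /= inordK.
  rewrite !permE /= !(eq_k _ i4) !(eq_k _ i4').
  by case: eqP => // _; [|case: eqP => // _]; rewrite inord_val.
by rewrite xrowE det_mulmx det_perm /pivot det01E mulf_eq0 signr_eq0.
Qed.

Lemma pivot_xrow_tail M (i i' : 'I_6) :
  (4 <= i)%N -> (4 <= i')%N -> pivot (xrow i i' M) = pivot M.
Proof.
move=> i4 i4'; rewrite /pivot !det01E; congr (\det (mx01 int _) != 0).
apply/matrixP=> k l; rewrite !mxE /entry mxE tpermD //.
  by rewrite -val_eqE /= inordK; have := ltn_ord k; lia.
by rewrite -val_eqE /= inordK; have := ltn_ord k; lia.
Qed.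

Lemma perm_extending m n (f : 'I_m -> 'I_n.+1) : injective f ->
  exists s : 'S_n.+1, forall i : 'I_m, s (inord i) = f i.
Proof.
move=> f_inj; pose Is := [seq val (f i) | i <- enum 'I_m].
pose Js := [seq x <- iota 0 n.+1 | x \notin Is].
have sI : size Is = m by rewrite size_map size_enum_ord.
have uI : uniq Is.
  by rewrite map_inj_uniq ?enum_uniq // => i j /val_inj/f_inj.
have [|s sE] := @perm_of_iota n (Is ++ Js).
  apply: uniq_perm; rewrite ?iota_uniq //.
    rewrite cat_uniq uI filter_uniq ?iota_uniq //= andbT.
    by apply/hasPn=> x; rewrite mem_filter => /andP[].
  move=> x; rewrite mem_cat mem_filter !mem_iota; case Ix: (x \in Is) => //=.
  by case/mapP: Ix => i _ ->; rewrite ltn_ord.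
exists s => i; apply: val_inj; rewrite /= -sE.
have im : (i < n.+1)%N.
  apply: leq_trans (ltn_ord i) _.
  by rewrite -[m]card_ord -[n.+1]card_ord (leq_card f).
rewrite inordK // nth_cat sI ltn_ord (nth_map i) ?size_enum_ord //.
by rewrite nth_ord_enum.
Qed.

Lemma exists_pivot (F : numFieldType) (M : 'M[bool]_6) : \rank (mx01 F M) = 4%N ->
  exists s t : 'S_6, pivot (row_perm s (col_perm t M)).
Proof.
move=> /exists_free_rows[f f_inj /eqP rf].
have /exists_free_rows[g g_inj ug] : \rank (rowsub f (mx01 F M))^T = 4%N.
  by rewrite mxrank_tr.
have [s sE] := perm_extending f_inj; have [t tE] := perm_extending g_inj.
exists s, t; rewrite (pivotE F) ulsub_mx01 -unitmx_tr -row_free_unit.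
congr row_free: ug; apply/matrixP=> i j; rewrite !mxE /entry !mxE.
by rewrite sE tE.
Qed.

(** * The lexicographic normal form *)

Definition binary_value (w : seq bool) : nat :=
  foldl (fun (acc : nat) (b : bool) => acc.*2 + b)%N 0%N w.

Definition precedes u v := (binary_value u < binary_value v)%N.

(** The row read as a binary number.  Weights of the form 2^(5-i) * 2^(5-j) in
    [key] make it linear in these row numbers and symmetric under
    transposition. *)
Definition line_code M i : nat := (\sum_(0 <= j < 6) 2 ^ (5 - j) * entry M i j)%N.

Definition key M : nat := (\sum_(0 <= i < 6) 2 ^ (5 - i) * line_code M i)%N.

Lemma key_tr M : key M^T = key M.
Proof.
rewrite /key /line_code.
under eq_bigr do rewrite big_distrr /=.
under [RHS]eq_bigr do rewrite big_distrr /=.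
rewrite exchange_big /=; apply: eq_bigr => i _; apply: eq_bigr => j _.
by rewrite entry_tr mulnCA.
Qed.

(** Exchanging the rows changes the key by
    (2^(5-i) - 2^(5-i')) * (line_code i' - line_code i). *)
Lemma key_swap M (i i' : 'I_6) : (i < i')%N ->
  (key M <= key (xrow i i' M))%N -> (line_code M i <= line_code M i')%N.
Proof.
move=> lt_ii'; rewrite /key !big_mkord.
have eq_code (k : 'I_6) : line_code (xrow i i' M) k = line_code M (tperm i i' k).
  by apply: eq_bigr => j _; rewrite /entry mxE !inord_val.
under [leqRHS]eq_bigr do rewrite eq_code.
have ne : i' != i by rewrite -val_eqE /= gtn_eqF.
rewrite (bigD1 i) //= (bigD1 i') //= [leqRHS](bigD1 i) //=.
rewrite [X in (_ <= _ + X)%N](bigD1 i') //= tpermL tpermR.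
rewrite [X in (_ <= _ + (_ + X))%N]
  (eq_bigr (fun k : 'I_6 => 2 ^ (5 - k) * line_code M k)%N); last first.
  by move=> k /andP[ki ki']; rewrite tpermD // eq_sym.
have: (2 ^ (5 - i') < 2 ^ (5 - i))%N.
  by rewrite ltn_exp2l //; have := ltn_ord i'; lia.
nia.
Qed.

(** The first four digits of a six-digit number are the most significant. *)
Lemma line_code_precedes M i i' : (line_code M i <= line_code M i')%N ->
  lead_row M i != lead_row M i' -> precedes (lead_row M i) (lead_row M i').
Proof.
rewrite /line_code /lead_row /precedes unlock /= /binary_value /= => le_ii' ne.
rewrite ltn_neqAle; apply/andP; split; last first.
  (* Numerals instead of powers make the comparison linear. *)
  move: le_ii'; clear ne; rewrite -[(2 ^ (5 - 0))%N]/32%N -[(2 ^ (5 - 1))%N]/16%N.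
  rewrite -[(2 ^ (5 - 2))%N]/8%N -[(2 ^ (5 - 3))%N]/4%N -[(2 ^ (5 - 4))%N]/2%N.
  rewrite -[(2 ^ (5 - 5))%N]/1%N.
  have := leq_b1 (entry M i' 4); have := leq_b1 (entry M i' 5).
  do 12!move: (nat_of_bool _) => ?.
  by lia.
apply: contra ne.
by do 4!case: (entry M i _); do 4!case: (entry M i' _).
Qed.

Definition row_minimal M : Prop :=
  forall i i' : 'I_6, pivot (xrow i i' M) -> (key M <= key (xrow i i' M))%N.

Lemma permuted_minimal M (s0 t0 : 'S_6) :
    pivot (row_perm s0 (col_perm t0 M)) ->
  exists s t : 'S_6, let N := row_perm s (col_perm t M) in
    [/\ pivot N, row_minimal N & row_minimal N^T].
Proof.
pose N (p : 'S_6 * 'S_6) := row_perm p.1 (col_perm p.2 M).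
rewrite -[row_perm _ _]/(N (s0, t0)) => piv0.
have [[s t] piv_st min_st] :=
  @arg_minnP _ (s0, t0) (fun p => pivot (N p)) (fun p => key (N p)) piv0.
exists s, t; split=> // i i'; last rewrite -tr_xcol !key_tr pivot_tr => piv.
  by rewrite /xrow -row_permM; apply: (min_st (_, t)).
move: piv; rewrite /xcol col_row_permC -col_permM.
exact: (min_st (s, _)).
Qed.

Fixpoint is_sum (u v w : seq bool) : bool :=
  match u, v, w with
  | a :: u', b :: v', c :: w' =>
      if (a + b == c :> nat)%N then is_sum u' v' w' else false
  | _, _, _ => true
  end.

(** The summands [u] and [v] may coincide with each other or with [w]; this also
    excludes the zero word [w], as [w + w = w]. *)
Definition sum_free (s : table) : bool :=
  all (fun u => all (fun v => all (fun w => ~~ is_sum u v w) s) s) s.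

(** The order is tested first, and by a conditional: evaluated eagerly, [&&] would
    run the cubic test on unsorted sequences too. *)
Definition arranged (s : table) : bool :=
  if sorted precedes s then sum_free s else false.

Lemma is_sum_map (f g h : nat -> bool) (l : seq nat) :
  is_sum [seq f j | j <- l] [seq g j | j <- l] [seq h j | j <- l] =
    all (fun j => (f j + g j == h j :> nat)%N) l.
Proof. by elim: l => //= j l ->; case: eqP. Qed.

Lemma sum_freeP (s : table) :
  reflect {in s & &, forall u v w, ~~ is_sum u v w} (sum_free s).
Proof.
apply: (iffP allP) => [sf u v w su sv sw | sf u su].
  by have /allP/(_ v sv)/allP/(_ w sw) := sf u su.
by apply/allP=> v sv; apply/allP=> w sw; apply: sf.
Qed.

Lemma sum_free_sub (s s' : table) :
  {subset s <= s'} -> sum_free s' -> sum_free s.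
Proof.
move=> ss /sum_freeP sf; apply/sum_freeP=> u v w /ss su /ss sv /ss sw.
exact: sf.
Qed.

(** As in [sum_free], no indices are required to be distinct. *)
Definition row_sum_free (M : 'M[bool]_6) : Prop :=
  forall i1 i2 i3 : 'I_6, exists j, (M i1 j + M i2 j != M i3 j :> nat)%N.

(** The conditions on the rows; a matrix is normalized when both it and its
    transpose satisfy them. *)
Record lex_normal (F : numFieldType) (M : 'M[bool]_6) : Prop := Normal {
  normal_rank : \rank (mx01 F M) = 4%N;
  normal_pivot : pivot M;
  normal_minimal : row_minimal M;
  normal_distinct : forall i i', row i M = row i' M -> i = i';
  normal_sum_free : row_sum_free M }.

(** Row [r] times the adjugate of the block [B]: the coefficients of the linear
    dependence, a circuit, between [r] and the rows of [B], up to the factor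
    [det B]. *)
Definition circuit (B : table) (r : seq bool) : seq int :=
  [seq sumz 4 (fun k => if nth false r k then cof01 4 (cell B) i k else 0)
     | i <- iota 0 4].

Lemma circuit_lead_block M p i : (i < 4)%N ->
  nth 0 (circuit (lead_block M) (lead_row M p)) i =
    \sum_(k < 4) (if entry M p k then cof01 4 (entry M) i k else 0).
Proof.
move=> i4; rewrite (nth_map 0%N) ?size_iota // nth_iota // sumzE.
apply: eq_bigr => k _; rewrite /lead_row (nth_map 0%N) ?size_iota ?nth_iota //.
by rewrite !(cof01E _ (Ordinal i4)) mx_lead_block.
Qed.

(** The row [r] comes after each row that it could replace in the block. *)
Definition exchange_ordered (B : table) r :=
  let lam := circuit B r in
  all (fun i => (nth 0 lam i == 0) || precedes (nth [::] B i) r) (iota 0 4).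

(** The possible pairs of further rows below the block [B], four entries wide;
    applied to the transposed block, the possible pairs of further columns. *)
Definition extensions (B : table) : seq table :=
  let Rs := [seq r <- words 4 | exchange_ordered B r] in
  choices (fun s => if sorted precedes s then sum_free (B ++ s) else false)
    [:: Rs; Rs].

Section NormalRows.
Variables (F : numFieldType) (M : 'M[bool]_6).
Hypothesis nM : lex_normal F M.

(** Used below with coefficients 1, -1 for the equality of two rows, and 1, 1, -1
    for a sum of two rows. *)
Lemma lead_relation (a : 'I_6 -> F) :
    (forall j, (j < 4)%N -> \sum_i a i * (entry M i j)%:R = 0) ->
  forall j : 'I_6, \sum_i a i * (M i j)%:R = 0.
Proof.
move=> a0 j; pose v : 'rV[F]_6 := \row_i a i.
have rM := normal_rank nM; have := normal_pivot nM; rewrite (pivotE F) => uM.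
have /rowP/(_ j) : v *m mx01 F M = 0.
  apply: (@lsubmx_relation F 4 2 2 _ rM uM v); apply/rowP=> k.
  rewrite !mxE -[RHS](a0 _ (ltn_ord k)).
  by apply: eq_bigr => i _; rewrite !mxE -entry_val.
by rewrite !mxE => vM0; rewrite -[RHS]vM0; apply: eq_bigr => i _; rewrite !mxE.
Qed.

Lemma sum_pick (x : 'I_6 -> F) i : \sum_k (k == i)%:R * x k = x i.
Proof.
rewrite (bigD1 i) //= eqxx mul1r big1 ?addr0 // => k /negbTE->.
by rewrite mul0r.
Qed.

Lemma lead_row_inj (i i' : 'I_6) : lead_row M i = lead_row M i' -> i = i'.
Proof.
move=> eq_ii'; apply: (normal_distinct nM); apply/rowP=> j; rewrite !mxE.
pose a (k : 'I_6) : F := (k == i)%:R - (k == i')%:R.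
have sum_a (x : 'I_6 -> F) : \sum_k a k * x k = x i - x i'.
  by under eq_bigr do rewrite mulrBl; rewrite sumrB !sum_pick.
have /(_ j) : forall j : 'I_6, \sum_k a k * (M k j)%:R = 0.
  apply: lead_relation => k k4; rewrite sum_a.
  have := congr1 (fun s => nth false s k) eq_ii'.
  rewrite /lead_row !(nth_map 0%N) ?size_iota // !nth_iota // => ->.
  by rewrite subrr.
rewrite sum_a => /eqP; rewrite subr_eq0 eqr_nat.
by do 2!case: (M _ j).
Qed.

Lemma lead_row_is_sum (i1 i2 i3 : 'I_6) :
  ~~ is_sum (lead_row M i1) (lead_row M i2) (lead_row M i3).
Proof.
rewrite is_sum_map; apply/negP=> /allP sumM.
pose a (k : 'I_6) : F := (k == i1)%:R + (k == i2)%:R - (k == i3)%:R.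
have sum_a (x : 'I_6 -> F) : \sum_k a k * x k = x i1 + x i2 - x i3.
  under eq_bigr do rewrite mulrBl mulrDl.
  by rewrite sumrB big_split /= !sum_pick.
have [j] := normal_sum_free nM i1 i2 i3; apply/negP; rewrite negbK.
have /(_ j) : forall j : 'I_6, \sum_k a k * (M k j)%:R = 0.
  apply: lead_relation => k k4; rewrite sum_a -natrD (eqP (sumM k _)) ?subrr //.
  by rewrite mem_iota.
by rewrite sum_a -natrD => /eqP; rewrite subr_eq0 eqr_nat.
Qed.

Lemma sum_free_lead_rows : sum_free [seq lead_row M i | i <- iota 0 6].
Proof.
apply/sum_freeP=> u v w /mapP[i i6 ->] /mapP[j j6 ->] /mapP[k k6 ->].
rewrite !mem_iota /= in i6 j6 k6.
exact: (lead_row_is_sum (Ordinal i6) (Ordinal j6) (Ordinal k6)).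
Qed.

Lemma lead_row_precedes (i i' : 'I_6) : (i < i')%N -> pivot (xrow i i' M) ->
  precedes (lead_row M i) (lead_row M i').
Proof.
move=> lt_ii' /(normal_minimal nM)/(key_swap lt_ii')/line_code_precedes; apply.
by apply: contraTneq lt_ii' => /lead_row_inj->; rewrite ltnn.
Qed.

Lemma arranged_lead_block : arranged (lead_block M).
Proof.
rewrite /arranged; have -> : sorted precedes (lead_block M).
  have lt_lead (i i' : 'I_6) :
      (i < i' < 4)%N -> precedes (lead_row M i) (lead_row M i').
    move=> /andP[lt_ii' lt_i'4]; apply: lead_row_precedes => //.
    by rewrite pivot_xrow_lead ?(normal_pivot nM) // (ltn_trans lt_ii').
  rewrite /= (lt_lead (@Ordinal 6 0 isT) (@Ordinal 6 1 isT)) //.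
  rewrite (lt_lead (@Ordinal 6 1 isT) (@Ordinal 6 2 isT)) //.
  by rewrite (lt_lead (@Ordinal 6 2 isT) (@Ordinal 6 3 isT)).
apply: sum_free_sub sum_free_lead_rows => w.
by rewrite (mem_cat _ (lead_block M) [:: lead_row M 4; lead_row M 5]) => ->.
Qed.

Lemma lead_block_in_choices : lead_block M \in choices arranged (nseq 4 (words 4)).
Proof.
apply: choices_complete arranged_lead_block _ => [w s|].
  rewrite /arranged; case: ifP => //= sws.
  rewrite (path_sorted sws); apply: sum_free_sub => u.
  by rewrite inE orbC => ->.
by rewrite /= !(mem_words (lead_row M _)).
Qed.

Lemma exchange_ordered_tail (p : 'I_6) :
  (4 <= p)%N -> exchange_ordered (lead_block M) (lead_row M p).
Proof.
move=> p4; apply/allP=> i; rewrite mem_iota => /= i4.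
rewrite (circuit_lead_block M p i4).
case: eqP => //= /eqP nz.
have i6 : (i < 6)%N by apply: leq_trans i4 _.
rewrite /lead_block (nth_map 0%N) ?size_iota // nth_iota //.
apply: (@lead_row_precedes (Ordinal i6)); first exact: leq_trans i4 p4.
by rewrite pivot_exchange.
Qed.

Lemma tail_in_extensions :
  [:: lead_row M 4; lead_row M 5] \in extensions (lead_block M).
Proof.
pose i4 := @Ordinal 6 4 isT; pose i5 := @Ordinal 6 5 isT.
have tailP (p : 'I_6) : (4 <= p)%N ->
    lead_row M p \in [seq r <- words 4 | exchange_ordered (lead_block M) r].
  move=> p4; rewrite mem_filter exchange_ordered_tail //.
  exact: (mem_words (lead_row M p)).
apply: choices_complete => [w s||].
- case: ifP => // sws; rewrite (path_sorted sws); apply: sum_free_sub => u.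
  by rewrite !mem_cat inE => /orP[] ->; rewrite ?orbT.
- rewrite /= (lead_row_precedes (i := i4) (i' := i5)) //.
    exact: sum_free_lead_rows.
  by rewrite pivot_xrow_tail // (normal_pivot nM).
apply/and3P; split=> //; [exact: (tailP i4) | exact: (tailP i5)].
Qed.
End NormalRows.

(** Repeated indices give no further sums: with [i1 = i2] or with [i3] among the
    summands, some row would be zero. *)
Lemma basic_row_sum_free M : basic_rows M -> ~~ two_sum_rows M -> row_sum_free M.
Proof.
move=> /andP[/forallP nz0 _] no2 i1 i2 i3.
have nz i : exists j, M i j by apply/existsP.
have [j|eqM] := pickP (fun j => M i1 j + M i2 j != M i3 j :> nat)%N.
  by exists j.
have {}eqM j : (M i1 j + M i2 j = M i3 j :> nat)%N.
  by apply/eqP; rewrite -[_ == _]negbK eqM.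
have [j1 M1] := nz i1; have [j2 M2] := nz i2.
case/negP: no2; apply/two_sum_rowsP; exists i1, i2, i3; split=> //.
- by apply/eqP=> eq12; have := eqM j1; rewrite -eq12 M1; case: (M i3 j1).
- by apply/eqP=> eq13; have := eqM j2; rewrite -eq13 M2; case: (M i1 j2).
by apply/eqP=> eq23; have := eqM j1; rewrite -eq23 M1; case: (M i2 j1).
Qed.

Lemma lex_normal_permuted (F : numFieldType) M (s t : 'S_6) :
    \rank (mx01 F M) = 4%N -> basic_rows M -> ~~ two_sum_rows M ->
  let N := row_perm s (col_perm t M) in
  pivot N -> row_minimal N -> lex_normal F N.
Proof.
move=> rM bM no2 N pN mN; split=> // [|i i' /rowP eqN|i1 i2 i3].
- by rewrite -(mxrank_perm _ s t) in rM; rewrite /mx01 map_row_perm map_col_perm.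
- case/andP: bM => _ /forallP/(_ (s i))/forallP/(_ (s i'))/implyP eqM.
  apply/(@perm_inj _ s)/eqP/eqM/eqP/rowP=> j; have := eqN (t^-1%g j).
  by rewrite !mxE permKV.
have [j neq] := basic_row_sum_free bM no2 (s i1) (s i2) (s i3).
by exists (t^-1%g j); rewrite !mxE permKV.
Qed.

(** * The enumeration *)

Local Ltac table_of A :=
  let t := eval unfold A in A in
  match t with mx_of_rows _ ?s => exact (bits s) end.
Definition C6_table : table := ltac:(table_of C6).
Definition A1_table : table := ltac:(table_of A1).
Definition A2_table : table := ltac:(table_of A2).
Definition A3_table : table := ltac:(table_of A3).

Definition exceptional (L : table) :=
  has (fun N => permutable L N || permutable L (transpose_table 6 N))
    [:: C6_table; A1_table; A2_table; A3_table].

Lemma exceptional_equivalent L M : tabulates L M -> exceptional L ->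
  [\/ equivalent M C6, equivalent M A1, equivalent M A2 | equivalent M A3].
Proof.
move=> LM; have iso_or N T : tabulates T N ->
    permutable L T || permutable L (transpose_table 6 T) -> equivalent M N.
  move=> TN /orP[|] iso; first exact: permutable_equivalent LM TN iso.
  apply: equivalent_trans (permutable_equivalent LM (tabulates_tr TN) iso) _.
  apply/equivalentP; exists 1%g, 1%g; right=> i j.
  by rewrite mxE !perm1.
have tC6 : tabulates C6_table C6 by apply: tabulates_rows.
have tA1 : tabulates A1_table A1 by apply: tabulates_rows.
have tA2 : tabulates A2_table A2 by apply: tabulates_rows.
have tA3 : tabulates A3_table A3 by apply: tabulates_rows.
case/hasP=> T; rewrite !inE => /or4P[] /eqP->.
- by move/(iso_or C6 C6_table tC6)/Or41.
- by move/(iso_or A1 A1_table tA1)/Or42.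
- by move/(iso_or A2 A2_table tA2)/Or43.
by move/(iso_or A3 A3_table tA3)/Or44.
Qed.

Definition assemble (B : table) r5 r6 c5 c6 (e55 e56 e65 e66 : bool) :=
  [seq p.1 ++ [:: p.2.1; p.2.2] | p <-
     zip (B ++ [:: r5; r6]) (zip (c5 ++ [:: e55; e65]) (c6 ++ [:: e56; e66]))].

Lemma assemble_tabulates M :
  tabulates (assemble (lead_block M) (lead_row M 4) (lead_row M 5)
    (lead_row M^T 4) (lead_row M^T 5)
    (entry M 4 4) (entry M 4 5) (entry M 5 4) (entry M 5 5)) M.
Proof.
split=> // i j; rewrite -entry_val; case: i j => [i i6] [j j6] /=.
rewrite /assemble /lead_block /lead_row /= !entry_tr.
by do 6?[case: i i6 => [|i] i6 //]; do 6?[case: j j6 => [|j] j6 //].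
Qed.

(** The values [e] of an entry of the corner D that satisfy
    [det B * e = (r * adj B) * c]: at most one when [det B] is not zero, and
    possibly none. *)
Definition corner_values d (lam : seq int) (c : seq bool) : seq bool :=
  [seq e : bool <- [:: false; true] |
     sumz 4 (fun k => if nth false c k then nth 0 lam k else 0)
     == if e then d else 0].

Lemma schur_int (F : numFieldType) (M : 'M[bool]_6) :
    \rank (mx01 F M) = 4%N -> pivot M ->
  let N := mx01 int M in
  \det (@ulsubmx _ 4 2 4 2 N) *: @drsubmx _ 4 2 4 2 N =
    @dlsubmx _ 4 2 4 2 N *m \adj (@ulsubmx _ 4 2 4 2 N) *m @ursubmx _ 4 2 4 2 N.
Proof.
move=> rM; rewrite (pivotE F) => uM N.
have := @schur_adj F 4 2 2 _ rM uM; rewrite mx01_int -/N.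
rewrite -map_ulsubmx -map_ursubmx -map_dlsubmx -map_drsubmx.
rewrite det_map_mx -map_mx_adj -!map_mxM -map_mxZ => /matrixP eqN.
apply/matrixP=> i j; apply: (@intr_inj F).
by have := eqN i j; rewrite [LHS]mxE [RHS]mxE.
Qed.

Lemma corner_values_tail (F : numFieldType) (M : 'M[bool]_6) (p q : 'I_2) :
    \rank (mx01 F M) = 4%N -> pivot M ->
  entry M (4 + p) (4 + q) \in
    corner_values (det01 4 (cell (lead_block M)))
      (circuit (lead_block M) (lead_row M (4 + p))) (lead_row M^T (4 + q)).
Proof.
move=> rM pM; rewrite mem_filter !inE.
have -> : (entry M (4 + p) (4 + q) == false) || (entry M (4 + p) (4 + q) == true).
  by case: (entry _ _ _).
rewrite andbT det01E mx_lead_block -ulsub_mx01 sumzE.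
have /matrixP/(_ p q) := schur_int rM pM.
rewrite !mxE -!entry_val /= => schur.
pose d := \det (@ulsubmx _ 4 2 4 2 (mx01 int M)).
transitivity (d * (entry M (4 + p) (4 + q))%:R ==
  if entry M (4 + p) (4 + q) then d else 0); last first.
  by case: (entry M _ _); rewrite ?mulr1 ?mulr0 eqxx.
congr (_ == _); rewrite /d schur; apply: eq_bigr => k _.
rewrite (circuit_lead_block M _ (ltn_ord k)) /lead_row.
rewrite (nth_map 0%N) ?size_iota // nth_iota //.
rewrite entry_tr !mxE -entry_val /=.
case: (entry M k (4 + q)); rewrite ?mulr0 ?mulr1 //.
apply: eq_bigr => l _; rewrite !mxE -entry_val /= cof01E ulsub_mx01.
by case: (entry _ _ _); rewrite ?mul0r ?mul1r.
Qed.

Definition pivots := [seq B <- choices arranged (nseq 4 (words 4)) |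
  if arranged (transpose_table 4 B) then det01 4 (cell B) != 0 else false].

Definition check_extensions (B : table) : bool :=
  let d := det01 4 (cell B) in
  let col_pairs := extensions (transpose_table 4 B) in
  all (fun rs =>
    let r5 := nth [::] rs 0 in let r6 := nth [::] rs 1 in
    let l5 := circuit B r5 in let l6 := circuit B r6 in
    all (fun cs =>
      let c5 := nth [::] cs 0 in let c6 := nth [::] cs 1 in
      all (fun e55 =>
        all (fun e56 =>
          all (fun e65 =>
            all (fun e66 => exceptional (assemble B r5 r6 c5 c6 e55 e56 e65 e66))
              (corner_values d l6 c6))
            (corner_values d l6 c5))
          (corner_values d l5 c6))
        (corner_values d l5 c5))
      col_pairs)
    (extensions B).

Lemma pivots_checked : all check_extensions pivots.
Proof. by vm_compute. Qed.

Lemma normal_classification (F : numFieldType) M :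
    lex_normal F M -> lex_normal F M^T ->
  [\/ equivalent M C6, equivalent M A1, equivalent M A2 | equivalent M A3].
Proof.
move=> nM nMt; apply: exceptional_equivalent (assemble_tabulates M) _.
have rM := normal_rank nM; have pM := normal_pivot nM.
have /(allP pivots_checked)/allP/(_ _ (tail_in_extensions nM)) :
    lead_block M \in pivots.
  rewrite mem_filter (lead_block_in_choices nM).
  rewrite transpose_lead_block (arranged_lead_block nMt).
  by rewrite det01E mx_lead_block -det01E -/(pivot M) pM.
rewrite transpose_lead_block => /allP/(_ _ (tail_in_extensions nMt)).
move=> /allP/(_ _ (corner_values_tail ord0 ord0 rM pM)).
move=> /allP/(_ _ (corner_values_tail ord0 ord_max rM pM)).
move=> /allP/(_ _ (corner_values_tail ord_max ord0 rM pM)).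
by move=> /allP/(_ _ (corner_values_tail ord_max ord_max rM pM)).
Qed.

Theorem basic_rank4_classification (F : numFieldType) (M : 'M[bool]_6) :
    basic M -> \rank (mx01 F M) = 4%N -> ~~ two_sum_property M ->
  [\/ equivalent M C6, equivalent M A1, equivalent M A2 | equivalent M A3].
Proof.
case/andP=> bM bMt rM; rewrite negb_or => /andP[no2 no2t].
have [s0 [t0 /permuted_minimal[s [t]]]] := exists_pivot rM.
set N := row_perm s _ => -[pN mN mNt].
have eqMN : equivalent M N.
  by apply/equivalent_sym/equivalentP; exists s, t; left=> i j; rewrite !mxE.
have nN : lex_normal F N by apply: lex_normal_permuted.
have NtE : N^T = row_perm t (col_perm s M^T) by apply/matrixP=> i j; rewrite !mxE.
have nNt : lex_normal F N^T.
  rewrite NtE; apply: lex_normal_permuted => //; rewrite -?NtE ?pivot_tr //.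
  by rewrite /mx01 -map_trmx mxrank_tr.
by case: (normal_classification nN nNt) => eqN; [apply: Or41 | apply: Or42 |
  apply: Or43 | apply: Or44]; apply: equivalent_trans eqMN eqN.
Qed.

(** * The four matrices *)

Definition isolated_diagonal (T : table) k : bool :=
  all (fun i => cell T i i &&
    all (fun j => (i == j) || ~~ (cell T i j && cell T j i)) (iota 0 k)) (iota 0 k).

Lemma isolated_diagonal_le T M k : tabulates T M -> (k <= 6)%N ->
  isolated_diagonal T k -> (k <= isolation_number M)%N.
Proof.
move=> [_ MT] k6 /allP diag; pose h (i : 'I_k) := (widen_ord k6 i, widen_ord k6 i).
have h_inj : injective h by move=> i j [/val_inj].
have ki (i : 'I_k) : val i \in iota 0 k by rewrite mem_iota /=.
rewrite -[k in leqLHS]card_ord -cardsT -(card_imset _ h_inj).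
apply/isolation_number_ge/isolation_setP; split.
  by move=> _ /imsetP[i _ ->]; rewrite MT; have /andP[] := diag _ (ki i).
move=> _ _ /imsetP[i _ ->] /imsetP[j _ ->]; rewrite /compatible !MT /= => Mij.
have /andP[_ /allP/(_ _ (ki j))] := diag _ (ki i).
by rewrite Mij orbF => /eqP/val_inj->.
Qed.

Definition partitioned (T : table) (rects : seq (seq nat * seq nat)) : bool :=
  all (fun i => all (fun j =>
    cell T i j == count (fun r => (i \in r.1) && (j \in r.2)) rects :> nat)
    (iota 0 6)) (iota 0 6).

Lemma partitioned_rank_bin T M rects : tabulates T M -> partitioned T rects ->
  (rank_bin M <= size rects)%N.
Proof.
move=> [_ MT] /allP part; apply/rank_bin_le/bin_factorP.
pose r k := nth ([::], [::]) rects k.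
exists (fun i (k : 'I_(size rects)) => (i : nat) \in (r k).1).
exists (fun k j => (j : nat) \in (r k).2) => i j.
have o6 (x : 'I_6) : (x : nat) \in iota 0 6 by rewrite mem_iota /=.
rewrite MT (eqP (allP (part _ (o6 i)) _ (o6 j))) -sum1_count big_mkcond /=.
rewrite (big_nth ([::], [::])) big_mkord; apply: eq_bigr => k _.
by rewrite -/(r k); case: andb.
Qed.

Definition compatible_entries (T : table) (p q : nat * nat) : bool :=
  cell T p.1 q.2 && cell T q.1 p.2.

(** Positions rather than entries are compared, as an entry may be repeated. *)
Definition no_compatible_triple (T : table) (s : seq (nat * nat)) : bool :=
  let compat a b := compatible_entries T (nth (0, 0)%N s a) (nth (0, 0)%N s b) in
  all (fun a => all (fun b => all (fun c =>
    [|| ~~ compat a b, ~~ compat b c, ~~ compat c a | ~~ uniq [:: a; b; c]])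
    (iota 0 (size s))) (iota 0 (size s))) (iota 0 (size s)).

Lemma fooling_triples_rank_bool T M s : tabulates T M ->
    all (fun p => [&& p.1 < 6, p.2 < 6 & cell T p.1 p.2]%N) s ->
  no_compatible_triple T s -> (size s <= 2 * rank_bool M)%N.
Proof.
move=> [_ MT] /(all_nthP (0, 0)%N) s1 triples.
pose p (a : 'I_(size s)) : 'I_6 * 'I_6 :=
  (inord (nth (0, 0)%N s a).1, inord (nth (0, 0)%N s a).2).
rewrite -[leqLHS]card_ord; apply: (rank_bool_fooling (p := p)) => [a|K compK].
  by have /and3P[? ? ?] := s1 a (ltn_ord a); rewrite MT !inordK.
rewrite leqNgt; apply/negP=> /card_gt2P[a [b [c [[Ka Kb Kc] [nab nbc nca]]]]].
have sa (x : 'I_(size s)) : val x \in iota 0 (size s) by rewrite mem_iota /=.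
have /allP/(_ _ (sa b))/allP/(_ _ (sa c)) := allP triples _ (sa a).
have compE x y : compatible M (p x) (p y) =
    compatible_entries T (nth (0, 0)%N s x) (nth (0, 0)%N s y).
  have /and3P[? ? _] := s1 x (ltn_ord x); have /and3P[? ? _] := s1 y (ltn_ord y).
  by rewrite /compatible !MT !inordK.
by rewrite -!compE !compK //= !inE negb_or nab nbc eq_sym nca.
Qed.

Definition isolated_transversals (T : table) : seq (seq (nat * nat)) :=
  choices (pairwise (fun p q => ~~ compatible_entries T p q))
    [seq [seq (i, j) | j <- iota 0 6 & cell T i j] | i <- iota 0 6].

(** An isolation set of size 6 has exactly one entry in each row. *)
Lemma isolation_number_lt6 T M : tabulates T M ->
  isolated_transversals T = [::] -> (isolation_number M <= 5)%N.
Proof.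
move=> [_ MT] none; apply/bigmax_leqP=> S /isolation_setP[S1 iS].
have fst_inj : {in S &, injective fst}.
  by move=> p q Sp Sq eq1; apply: iS => //; rewrite /compatible eq1 -{2}eq1 !S1.
rewrite -ltnS ltn_neqAle -(card_in_imset fst_inj).
rewrite (leq_trans (max_card _)) ?card_ord // andbT; apply/negP=> /eqP full.
have hit i : exists j, (i, j) \in S.
  have: i \in [set p.1 | p in S].
    suff -> : [set p.1 | p in S] = setT by rewrite inE.
    by apply/eqP; rewrite eqEcard subsetT cardsT card_ord full.
  by case/imsetP=> [[i' j] Sp ->]; exists j.
pose g i := xchoose (hit i); have gS i : (i, g i) \in S := xchooseP (hit i).
pose e i : nat * nat := (i, val (g (inord i))).
suff : [seq e i | i <- iota 0 6] \in isolated_transversals T by rewrite none.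
apply: choices_complete => [x u /= /andP[] //||].
  rewrite pairwise_map; have := iota_uniq 0 6; rewrite uniq_pairwise.
  apply: (sub_in_pairwise (P := [pred i | i < 6]%N)) => //.
  move=> i j; rewrite !inE => i6 j6; apply: contra => /andP[/= Tij Tji].
  have := iS _ _ (gS (inord i)) (gS (inord j)).
  rewrite /compatible !MT /= !inordK // Tij Tji => /(_ isT).
  move/(congr1 (val \o fst)) => /=.
  by rewrite !inordK // => ->.
rewrite all2E !size_map eqxx zip_map all_map.
apply/allP=> i; rewrite mem_iota => i6.
apply: (map_f (pair i)); rewrite mem_filter mem_iota ltn_ord andbT.
by have := S1 _ (gS (inord i)); rewrite MT /= inordK // => ->.
Qed.

Lemma A1_ranks : [/\ rank_bin A1 = 5, rank_bool A1 = 5 & isolation_number A1 = 5].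
Proof.
have tab : tabulates A1_table A1 by apply: tabulates_rows.
have iso : (5 <= isolation_number A1)%N by apply: (isolated_diagonal_le tab).
have bin : (rank_bin A1 <= 5)%N.
  pose rects := [:: ([:: 0], [:: 0; 1; 4]); ([:: 1; 3], [:: 1; 5]);
    ([:: 1; 4; 5], [:: 2; 4]); ([:: 2], [:: 2; 3; 5]); ([:: 3; 5], [:: 0; 3])]%N.
  exact: (partitioned_rank_bin (rects := rects) tab).
have := isolation_le_rank_bool A1; have := rank_bool_le_bin A1.
by split; apply/eqP; rewrite eqn_leq; lia.
Qed.

Lemma A2_ranks : [/\ rank_bin A2 = 5, rank_bool A2 = 5 & isolation_number A2 = 5].
Proof.
have tab : tabulates A2_table A2 by apply: tabulates_rows.
have iso : (5 <= isolation_number A2)%N by apply: (isolated_diagonal_le tab).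
have bin : (rank_bin A2 <= 5)%N.
  pose rects := [:: ([:: 0; 5], [:: 0; 1]); ([:: 0; 2], [:: 2; 5]);
    ([:: 1], [:: 1; 3; 5]); ([:: 3; 5], [:: 3; 4]); ([:: 4], [:: 0; 2; 4])]%N.
  exact: (partitioned_rank_bin (rects := rects) tab).
have := isolation_le_rank_bool A2; have := rank_bool_le_bin A2.
by split; apply/eqP; rewrite eqn_leq; lia.
Qed.

(** An optimal solution of the linear program dual to fractional covering by
    rectangles, with weights doubled: its value 11/2 exceeds 5.  The entry
    (4, 0) has weight 2, hence occurs twice. *)
Definition A3_fooling : seq (nat * nat) :=
  [:: (4, 0); (4, 0); (0, 2); (2, 2); (3, 4); (1, 3); (0, 1); (5, 1); (2, 4);
      (3, 5); (5, 5)]%N.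

Lemma A3_ranks : [/\ rank_bin A3 = 6, rank_bool A3 = 6 & isolation_number A3 = 5].
Proof.
have tab : tabulates A3_table A3 by apply: tabulates_rows.
have iso : (5 <= isolation_number A3)%N by apply: (isolated_diagonal_le tab).
have iso_lt6 : (isolation_number A3 <= 5)%N.
  by apply: (isolation_number_lt6 tab); vm_compute.
have fool : (11 <= 2 * rank_bool A3)%N.
  by apply: (fooling_triples_rank_bool (s := A3_fooling) tab); vm_compute.
have := rank_bool_le_bin A3; have := rank_bin_max A3.
by split; apply/eqP; rewrite eqn_leq; lia.
Qed.

Lemma C6_ranks : [/\ rank_bin C6 = 6, rank_bool C6 = 6 & isolation_number C6 = 6].
Proof.
have tab : tabulates C6_table C6 by apply: tabulates_rows.
have iso : (6 <= isolation_number C6)%N by apply: (isolated_diagonal_le tab).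
have := isolation_le_rank_bool C6; have := rank_bool_le_bin C6.
have := rank_bin_max C6.
by split; apply/eqP; rewrite eqn_leq; lia.
Qed.

Lemma ranks_equivalent n (M N : 'M[bool]_n) a b c : equivalent M N ->
    [/\ rank_bin N = a, rank_bool N = b & isolation_number N = c] ->
  rank_bin M = a /\ rank_bool M = b /\ isolation_number M = c.
Proof.
move=> eqMN [<- <- <-].
rewrite (rank_bin_equivalent eqMN) (rank_bool_equivalent eqMN).
by rewrite (isolation_equivalent eqMN).
Qed.

Local Close Scope ring_scope.

Theorem lemma20 (R : realType) (M : 'M[bool]_6)
    (M_basic : basic M) (M_rank : \rank (mx01 R M) = 4) :
  (two_sum_property M
   \/ equivalent M C6 \/ equivalent M A1 \/ equivalent M A2 \/ equivalent M A3)
  /\ (two_sum_property M -> rank_bin M <= 5 /\ rank_bool M <= 5)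
  /\ (equivalent M A1 \/ equivalent M A2 ->
        rank_bin M = 5 /\ rank_bool M = 5 /\ isolation_number M = 5)
  /\ (equivalent M A3 ->
        rank_bin M = 6 /\ rank_bool M = 6 /\ isolation_number M = 5)
  /\ (equivalent M C6 ->
        rank_bin M = 6 /\ rank_bool M = 6 /\ isolation_number M = 6).
Proof.
split; [|split; [|split; [|split]]].
- have [two|no2] := boolP (two_sum_property M); [by left | right].
  by case: (basic_rank4_classification M_basic M_rank no2) => eqM; tauto.
- move=> two; have bin5 : rank_bin M <= 5.
    case/orP: two => /two_sum_rank_bin // le5.
    by apply: leq_trans le5; rewrite -{1}[M]trmxK rank_bin_tr.
  by split=> //; apply: leq_trans (rank_bool_le_bin M) bin5.
- by case=> eqM; [apply: (ranks_equivalent eqM A1_ranks) |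
    apply: (ranks_equivalent eqM A2_ranks)].
- by move=> eqM; apply: (ranks_equivalent eqM A3_ranks).
- by move=> eqM; apply: (ranks_equivalent eqM C6_ranks).
Qed.
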